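(* Let $G,H$ be set-system hypergraphs and let $[G,H]_\beta$ and $\beta\mathrm{ev}_H^G:G\Box[G,H]_\beta\to H$ be as in the context. For every set-system hypergraph $K$ and every homomorphism $\phi:G\Box K\to H$ there is a unique homomorphism $\hat\phi:K\to[G,H]_\beta$ such that $\beta\mathrm{ev}_H^G\circ(G\Box\hat\phi)=\phi$.
   Context: A set-system hypergraph $G$ is $(V(G),E(G),\epsilon_G)$ with $\epsilon_G:E(G)\to\mathcal PV(G)$; a homomorphism $\phi:G\to H$ is a pair of functions $V(\phi),E(\phi)$ with $\epsilon_H(E(\phi)(e))=\{V(\phi)(x):x\in\epsilon_G(e)\}$ for all $e$; $\mathfrak H(G,H)$ is the set of homomorphisms. Box product: $V(G\Box H)=V(G)\times V(H)$, $E(G\Box H)=(\{1\}\times E(G)\times V(H))\cup(\{2\}\times V(G)\times E(H))$, $\epsilon(1,x,y)=\epsilon_G(x)\times\{y\}$, $\epsilon(2,x,y)=\{x\}\times\epsilon_H(y)$; on morphisms $(v,w)\mapsto(V\phi(v),V\psi(w))$, $(1,x,y)\mapsto(1,E\phi(x),V\psi(y))$, $(2,x,y)\mapsto(2,V\phi(x),E\psi(y))$. Box exponential: $V[G,H]_\beta=\mathfrak H(G,H)$; $E[G,H]_\beta=\{(A,g):A\subseteq\mathfrak H(G,H),\ g:V(G)\to E(H),\ \epsilon_H(g(v))=\{V(\phi)(v):\phi\in A\}\text{ for all }v\in V(G)\}$; $\epsilon(A,g)=A$. Evaluation: $V(\beta\mathrm{ev})(v,\phi)=V(\phi)(v)$,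 $E(\beta\mathrm{ev})(1,e,\phi)=E(\phi)(e)$, $E(\beta\mathrm{ev})(2,v,(A,g))=g(v)$. *)

(* Defs.v *)
From mathcomp Require Import all_boot classical_sets.

Set Implicit Arguments.
Unset Strict Implicit.
Unset Printing Implicit Defensive.

Local Open Scope classical_set_scope.

(* Vertices and edges form arbitrary, possibly empty or infinite, types;
   an edge may be empty, and several edges may have the same endpoints. *)
Record hypergraph : Type := Hypergraph {
  hgV : Type;
  hgE : Type;
  hg_eps : hgE -> set hgV }.

Record hg_hom (G H : hypergraph) : Type := HgHom {
  homV : hgV G -> hgV H;
  homE : hgE G -> hgE H;
  hom_eps : forall e : hgE G, hg_eps (homE e) = homV @` hg_eps e }.

Lemma hg_id_eps (G : hypergraph) (e : hgE G) :
  hg_eps (id e) = id @` hg_eps e.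
Proof. by rewrite image_id. Qed.

Definition hg_id (G : hypergraph) : hg_hom G G := HgHom (@hg_id_eps G).

Lemma hg_comp_eps (G H K : hypergraph) (psi : hg_hom H K) (phi : hg_hom G H)
    (e : hgE G) :
  hg_eps (homE psi (homE phi e)) =
  (fun v => homV psi (homV phi v)) @` hg_eps e.
Proof. by rewrite !hom_eps image_comp. Qed.

Definition hg_comp (G H K : hypergraph) (psi : hg_hom H K) (phi : hg_hom G H) :
  hg_hom G K := HgHom (hg_comp_eps psi phi).

(* The tags 1 and 2 of the disjoint union of edges are inl and inr. *)
Definition box_eps (G H : hypergraph)
    (e : (hgE G * hgV H) + (hgV G * hgE H)) : set (hgV G * hgV H) :=
  match e with
  | inl (x, y) => hg_eps x `*` [set y]
  | inr (x, y) => [set x] `*` hg_eps y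
  end.

Definition box (G H : hypergraph) : hypergraph := Hypergraph (@box_eps G H).

Definition box_mapV (G G' H H' : hypergraph)
    (phi : hg_hom G G') (psi : hg_hom H H') (p : hgV (box G H)) :
    hgV (box G' H') :=
  (homV phi p.1, homV psi p.2).

Definition box_mapE (G G' H H' : hypergraph)
    (phi : hg_hom G G') (psi : hg_hom H H') (e : hgE (box G H)) :
    hgE (box G' H') :=
  match e with
  | inl (x, y) => inl (homE phi x, homV psi y)
  | inr (x, y) => inr (homV phi x, homE psi y)
  end.

Lemma box_map_eps (G G' H H' : hypergraph)
    (phi : hg_hom G G') (psi : hg_hom H H') (e : hgE (box G H)) :
  hg_eps (box_mapE phi psi e) = box_mapV phi psi @` hg_eps e.
Proof.
case: e => [[x y]|[x y]] /=; rewrite hom_eps; apply/seteqP; split.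
- by move=> [_ _] /= [[v xv <-] ->]; exists (v, y).
- by move=> _ [[v _] /= [xv ->] <-]; split => //=; exists v.
- by move=> [_ _] /= [-> [w yw <-]]; exists (x, w).
- by move=> _ [[_ w] /= [-> yw] <-]; split => //=; exists w.
Qed.

Definition box_map (G G' H H' : hypergraph)
    (phi : hg_hom G G') (psi : hg_hom H H') : hg_hom (box G H) (box G' H') :=
  HgHom (box_map_eps phi psi).

Definition box_exp_edge (G H : hypergraph) : Type :=
  {p : set (hg_hom G H) * (hgV G -> hgE H) |
    forall v : hgV G, hg_eps (p.2 v) = [set homV phi v | phi in p.1]}.

Definition box_exp_eps (G H : hypergraph) (a : box_exp_edge G H) :
    set (hg_hom G H) := (sval a).1.

Definition box_exp (G H : hypergraph) : hypergraph :=
  Hypergraph (@box_exp_eps G H).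

Definition box_evV (G H : hypergraph) (p : hgV (box G (box_exp G H))) :
    hgV H :=
  homV p.2 p.1.

Definition box_evE (G H : hypergraph) (e : hgE (box G (box_exp G H))) :
    hgE H :=
  match e with
  | inl (x, phi) => homE phi x
  | inr (v, a) => (sval a).2 v
  end.

Lemma box_ev_eps (G H : hypergraph) (e : hgE (box G (box_exp G H))) :
  hg_eps (box_evE e) = @box_evV G H @` hg_eps e.
Proof.
case: e => [[x phi]|[v [[A g] gP]]] /=.
- rewrite hom_eps; apply/seteqP; split.
  + by move=> _ [v xv <-]; exists (v, phi).
  + by move=> _ [[v _] /= [xv ->] <-]; exists v.
- rewrite gP; apply/seteqP; split.
  + by move=> _ [phi Aphi <-]; exists (v, phi).
  + by move=> _ [[_ phi] /= [-> Aphi] <-]; exists phi.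
Qed.

Definition box_ev (G H : hypergraph) : hg_hom (box G (box_exp G H)) H :=
  HgHom (@box_ev_eps G H).

(* Main.v *)
(* Currying in the vertex coordinate of K is forced on vertices and on the map
   component of an edge (A, g); the set component A is then determined as well,
   because it is the endpoint set of the edge, which a homomorphism must send
   to the image of the endpoint set upstairs. *)
Require Import Defs.
From mathcomp Require Import all_boot boolp classical_sets.

Set Implicit Arguments.
Unset Strict Implicit.
Unset Printing Implicit Defensive.

Local Open Scope classical_set_scope.

Lemma hg_hom_ext (G H : hypergraph) (f g : hg_hom G H) :
  homV f =1 homV g -> homE f =1 homE g -> f = g.
Proof.
case: f g => [fV fE fP] [gV gE gP] /= /funext eV /funext eE.
by subst gV gE; congr HgHom; exact: Prop_irrelevance.
Qed.

Lemma box_exp_edge_ext (G H : hypergraph) (a b : box_exp_edge G H) :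
  box_exp_eps a = box_exp_eps b -> (sval a).2 =1 (sval b).2 -> a = b.
Proof.
case: a b => [[A g] gP] [[B h] hP] /= eAB /funext egh.
by rewrite /box_exp_eps /= in eAB; subst B h; congr exist; exact: Prop_irrelevance.
Qed.

Section Transpose.
Variables (G H K : hypergraph) (phi : hg_hom (box G K) H).

(** The edge [inl (e, k)] has endpoint set [hg_eps e] times the singleton of [k], so [phi]
    restricted to the copy of [G] over [k] is a homomorphism. *)
Lemma slice_eps (k : hgV K) (e : hgE G) :
  hg_eps (homE phi (inl (e, k))) = (fun v => homV phi (v, k)) @` hg_eps e.
Proof.
rewrite hom_eps; apply/seteqP; split.
- by move=> _ [[v _] /= [ev ->] <-]; exists v.
- by move=> _ [v ev <-]; exists (v, k).
Qed.

Definition slice (k : hgV K) : hg_hom G H := HgHom (slice_eps k).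

(** This is the compatibility required of an edge of [box_exp G H]; it holds because [inr (v, e)]
    has as endpoints the pairs [(v, k)] with [k] in [hg_eps e], and [phi] sends such a pair to
    [homV (slice k) v]. *)
Lemma transpose_edgeP (e : hgE K) (v : hgV G) :
  hg_eps (homE phi (inr (v, e))) = [set homV f v | f in slice @` hg_eps e].
Proof.
rewrite hom_eps; apply/seteqP; split.
- by move=> _ [[_ k] /= [-> ek] <-]; exists (slice k) => //; exists k.
- by move=> _ [_ [k ek <-] <-]; exists (v, k).
Qed.

Definition transpose_edge (e : hgE K) : box_exp_edge G H :=
  exist _ (slice @` hg_eps e, fun v => homE phi (inr (v, e)))
    (transpose_edgeP e).

Definition transpose : hg_hom K (box_exp G H) :=
  @HgHom K (box_exp G H) slice transpose_edge (fun=> erefl).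

Lemma box_ev_transpose :
  hg_comp (box_ev G H) (box_map (hg_id G) transpose) = phi.
(* On vertices and on both kinds of edges the two sides agree by computation. *)
Proof. by apply: hg_hom_ext => [[v k]|[[e k]|[v e]]]. Qed.

End Transpose.

Lemma box_ev_inj (G H K : hypergraph) (f g : hg_hom K (box_exp G H)) :
  hg_comp (box_ev G H) (box_map (hg_id G) f) =
  hg_comp (box_ev G H) (box_map (hg_id G) g) -> f = g.
Proof.
move=> efg.
have eV p := congr1 (fun h => homV h p) efg.
have eE p := congr1 (fun h => homE h p) efg.
(* A vertex of [box_exp G H] is a whole homomorphism, so its edge map must be recovered too: this is
   what the [inl] edges provide. *)
have fgV : homV f =1 homV g.
  by move=> k; apply: hg_hom_ext => [v|e];
    [exact: (eV (v, k)) | exact: (eE (inl (e, k)))].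
apply: hg_hom_ext => // e; apply: box_exp_edge_ext => [|v].
- have := hom_eps g e; have := hom_eps f e.
  by rewrite (funext fgV) /= => -> ->.
- exact: (eE (inr (v, e))).
Qed.

Theorem mainTheorem12 (G H K : hypergraph) (phi : hg_hom (box G K) H) :
  exists! hphi : hg_hom K (box_exp G H),
    hg_comp (box_ev G H) (box_map (hg_id G) hphi) = phi.
Proof.
exists (transpose phi); split=> [|h hP]; first exact: box_ev_transpose.
by apply: box_ev_inj; rewrite box_ev_transpose hP.
Qed.
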